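(* Let $D^{\perp}\simeq\mathbf{D}_n$ with $n\ge 4$, or $D^{\perp}\simeq\mathbf{E}_n$ with $n\in\{6,7,8\}$, and let $\mathcal{X}_{D^{\perp}}=\mathcal{X}_{\mathbf{s}}$ be the corresponding $\mathcal{X}$-cluster variety. Then the Donaldson-Thomas transformation of $\mathcal{X}_{D^{\perp}}$ is cluster, that is, it can be factored as a composition of cluster transformations (mutations and seed isomorphisms).
   Context: **The seeds.** Put $I=\{1,\dots,n+2\}=I_1\sqcup I_2\sqcup I_3$, where in case $\mathbf{D}_n$ ($n\ge4$): $I_1=\{1,2\}$, $I_2=\{3,4\}$, $I_3=\{5,\dots,n+2\}$; and in case $\mathbf{E}_n$ ($n=6,7,8$): $I_1=\{1,2\}$, $I_2=\{3,4,5\}$, $I_3=\{6,\dots,n+2\}$. Let $N=\mathbb{Z}^{n+2}$ with basis $\mathbf{s}=(e_i)_{i\in I}$ and skew-symmetric form with $\{e_i,e_j\}=1$ if $(i,j)\in (I_1\times I_2)\cup(I_2\times I_3)\cup(I_3\times I_1)$, $\{e_i,e_j\}=-1$ if $(j,i)$ is in that set, and $\{e_i,e_j\}=0$ otherwise. No index is frozen. Geometrically: let $(Y,D)$ be obtained from $\mathbb{P}^2$ with its toric boundary $\overline D_1+\overline D_2+\overline D_3$ by blowing up $|I_a|$ general smooth points of the boundary on $\overline D_a$ ($a=1,2,3$), with exceptional curves $E_i$ ($i\in I_a$), $D$ being the strict transform of the toric boundary. The lattice $D^\perp=\{\alpha\in\mathrm{Pic}(Y):\alpha\cdot D_a=0,\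 a=1,2,3\}$ is a (negative definite) root lattice of type $\mathbf{D}_n$, resp. $\mathbf{E}_n$, and $\mathbf{s}$ is the seed attached to this toric model. $\mathcal{X}_{D^\perp}$ denotes the $\mathcal{X}$-cluster variety $\mathcal{X}_{\mathbf{s}}$ of $\mathbf{s}$. **Mutations and C-matrices.** Let $B=(b_{ij})$ with $b_{ij}=-\{e_i,e_j\}$ (Fomin-Zelevinsky convention) and form the $2(n+2)\times(n+2)$ matrix $\tilde B=\begin{pmatrix}B\\ \mathrm{Id}\end{pmatrix}$. Mutation of $\tilde B=(b_{ij})$ at $k\in I$ is: $b'_{ij}=-b_{ij}$ if $i=k$ or $j=k$, and $b'_{ij}=b_{ij}+\tfrac12(|b_{ik}|b_{kj}+b_{ik}|b_{kj}|)$ otherwise. After any finite sequence of mutations, the top square block is the exchange matrix of the resulting seed and the bottom square block $C$ is its C-matrix (its columns are the $\mathbf{c}$-vectors). A seed isomorphism is a relabelling of the indices identifying exchange matrices. A cluster transformation is a finite composition of mutations and seed isomorphisms. **Donaldson-Thomas transformation.** The Donaldson-Thomas (DT) transformation of $\mathcal{X}_{\mathbf{s}}$ is that of Kontsevich-Soibelman and Goncharov-Shen. In Goncharov-Shen's formulation, the DT-transformation is cluster precisely when there is a finite sequence of mutations starting at $\mathbf{s}$, with resulting seed $\mathbf{s}'$, whose C-matrix is $-P$ for some permutation matrix $P$; then $\mathbf{s}'$ is isomorphic to $\mathbf{s}$ via the corresponding permutation, and the DT-transformation is the birational automorphism of $\mathcal{X}_{\mathbf{s}}$ given by this sequence of mutations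 followed by that seed isomorphism. *)

(* Defs.v *)
From HB Require Import structures.
From mathcomp Require Import all_boot all_order all_algebra perm.
From mathcomp.multinomials Require Import mpoly.

Set Implicit Arguments.
Unset Strict Implicit.
Unset Printing Implicit Defensive.

Import Order.TTheory GRing.Theory Num.Theory.

Local Open Scope ring_scope.

(* Rational functions on the torus with coordinates X_i, i < m, over K. *)
Notation ratfun K m := {fraction {mpoly K[m]}}.

Section Seeds.

Variables (K : fieldType) (m : nat).

(* A seed reached from an initial one.  [ext] is the extended exchange matrix
   (top block: exchange matrix B, bottom block: C-matrix).  [coord] lists the
   X-coordinates of the seed, pulled back to rational functions of the
   X-coordinates of the initial seed; it records the birational map between
   the two seed tori. *)
Record seed := Seed {
  ext : 'M[int]_(m + m, m);
  coord : {ffun 'I_m -> ratfun K m} }.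

Definition exch (s : seed) : 'M[int]_m := usubmx (ext s).
Definition cmat (s : seed) : 'M[int]_m := dsubmx (ext s).

Definition init_coord : {ffun 'I_m -> ratfun K m} :=
  [ffun i => tofrac ('X_i : {mpoly K[m]})].

Definition init_seed (B : 'M[int]_m) : seed := Seed (col_mx B 1%:M) init_coord.

(* The division by 2 is exact: the numerator is 0 or +/- 2 b_ik b_kj. *)
Definition mut_ext (k : 'I_m) (A : 'M[int]_(m + m, m)) : 'M[int]_(m + m, m) :=
  let r := lshift m k in
  \matrix_(i, j)
    if (i == r) || (j == k) then - A i j
    else A i j + ((`|A i k| * A r j + A i k * `|A r j|) %/ 2)%Z.

(* X-mutation: X_k' = X_k^-1 and, for j <> k,
   X_j' = X_j X_k^{max(b_kj, 0)} (1 + X_k)^{- b_kj}.  Since b_kj = {e_j, e_k},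
   this is X_j (1 + X_k^{- sgn {e_j, e_k}})^{- {e_j, e_k}}. *)
Definition mut_coord (k : 'I_m) (B : 'M[int]_m)
    (X : {ffun 'I_m -> ratfun K m}) : {ffun 'I_m -> ratfun K m} :=
  [ffun j => if j == k then (X k)^-1
             else X j * X k ^ Num.max (B k j) 0 * (1 + X k) ^ (- B k j)].

Definition mutate (s : seed) (k : 'I_m) : seed :=
  Seed (mut_ext k (ext s)) (mut_coord k (exch s) (coord s)).

Definition mutate_seq (s : seed) (ks : seq 'I_m) : seed := foldl mutate s ks.

(* Index i of the new seed is index sigma i of the old one.  The rows of the
   C-matrix are indexed by the initial seed, hence are not relabelled. *)
Definition relabel (sigma : 'S_m) (s : seed) : seed :=
  Seed (col_mx (\matrix_(i, j) exch s (sigma i) (sigma j))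
               (\matrix_(i, j) cmat s i (sigma j)))
       [ffun i => coord s (sigma i)].

Inductive cluster_reachable (s0 : seed) : seed -> Prop :=
| cluster_refl : cluster_reachable s0 s0
| cluster_mut s k :
    cluster_reachable s0 s -> cluster_reachable s0 (mutate s k)
| cluster_iso s sigma :
    cluster_reachable s0 s -> cluster_reachable s0 (relabel sigma s).

(* A rational self-map of the seed torus of B is given by its components
   [phi i], the pullbacks of the coordinates X_i. *)
Definition cluster_automorphism (B : 'M[int]_m)
    (phi : {ffun 'I_m -> ratfun K m}) : Prop :=
  exists s, [/\ cluster_reachable (init_seed B) s,
                exch s = B & coord s = phi].

(* Goncharov-Shen: some mutation sequence has C-matrix -P, with P a permutation
   matrix; the permutation identifies the final seed with the initial one, and
   phi is the mutation sequence followed by that identification.  As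
   (perm_mx sigma) i j = 1 iff j = sigma i, the c-vector of index sigma i is
   -e_i, so that index i of B corresponds to index sigma i of the final seed. *)
Definition is_DT (B : 'M[int]_m) (phi : {ffun 'I_m -> ratfun K m}) : Prop :=
  exists (ks : seq 'I_m) (sigma : 'S_m),
    let s := mutate_seq (init_seed B) ks in
    [/\ cmat s = - perm_mx sigma,
        (forall i j, exch s (sigma i) (sigma j) = B i j)
      & phi = [ffun i => coord s (sigma i)]].

Definition DT_is_cluster (B : 'M[int]_m) : Prop :=
  exists phi, is_DT B phi /\ cluster_automorphism B phi.

End Seeds.

Arguments DT_is_cluster K {m} B.

Variant dynkin := typeD | typeE.

Definition admissible (T : dynkin) (n : nat) : bool :=
  match T with
  | typeD => (4 <= n)%N
  | typeE => n \in [:: 6; 7; 8]%N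
  end.

Definition card_I2 (T : dynkin) : nat :=
  match T with typeD => 2 | typeE => 3 end.

(* Indices are 0-based: I_1, I_2, I_3 are the fibres over 0, 1, 2, and I_3 has
   n - card_I2 T elements. *)
Definition block (T : dynkin) n (i : 'I_(n + 2)) : 'I_3 :=
  if (i < 2)%N then inord 0
  else if (i < 2 + card_I2 T)%N then inord 1
  else inord 2.

(* cyc a b iff (a, b) is one of (1, 2), (2, 3), (3, 1), up to the index shift. *)
Definition cyc (a b : 'I_3) : bool := b == ordS a.

(* Gram matrix {e_i, e_j} of the skew-symmetric form. *)
Definition skew_form (T : dynkin) n : 'M[int]_(n + 2) :=
  \matrix_(i, j)
    if cyc (block T i) (block T j) then 1
    else if cyc (block T j) (block T i) then -1
    else 0.

Definition exchange_matrix (T : dynkin) n : 'M[int]_(n + 2) := - skew_form T n.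

(* Main.v *)
Require Import Defs.
From mathcomp Require Import all_boot all_order all_algebra perm zify.

Set Implicit Arguments.
Unset Strict Implicit.
Unset Printing Implicit Defensive.

Import Order.TTheory GRing.Theory Num.Theory.

Local Open Scope ring_scope.

(** The theorem asks for a sequence of mutations whose C-matrix is minus a
    permutation matrix and which restores the exchange matrix up to that
    permutation; the cluster automorphism is then this sequence followed by the
    relabelling ([DT_is_cluster_of_C_matrix]).  The rational functions attached
    to the seeds only come along, so everything takes place in the integer
    matrices.

    For E_6, E_7, E_8 and D_4 there are finitely many matrices, and an explicit
    word in the indices is checked by computation ([DT_certificateP]).

    For D_n with n >= 5 the word depends on n, and the reason it works is
    geometric.  The form has rank 2: modulo its kernel, every e_i becomes a
    vector of Z^2 and the exchange matrix is the matrix of the determinants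
    of these vectors.  The initial seed is the fan of P^2, with 2, 2 and
    n - 2 indices on the three rays.  A few mutations lead to the fan of
    P(1,1,2), with n indices on one ray and a single index, p and q, on each
    of the other two.  The n indices play the same role, like the singular
    fibres of a conic bundle, and are called fibres below.  Mutating at a
    fibre x, then at q and p, gives such a pencil again, with the pair (q, x)
    in place of (p, q) ([pencil_rotate]).  After one rotation for each of the
    n initial fibres all c-vectors but three are opposites of basis vectors,
    and three more mutations lead back to the fan of P^2 and make this true
    of all of them ([pencil_collapse], [D_cmat_collapse]).

    The first rotations only involve the indices 0, ..., 6, and all the indices
    from 7 on behave alike under them, so that this part is a computation with
    one 8 x 8 matrix, whatever n is ([folds], [D_after_prefix]).  For the
    remaining ones the C-matrix has a closed form ([D_cmat]) that each rotation
    shifts by one index ([D_cmat_rotate]). *)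

(** * Mutation of single entries *)

Definition increment (a g : int) : int := ((`|a| * g + a * `|g|) %/ 2)%Z.

Lemma increment0 a : increment a 0 = 0.
Proof. by rewrite /increment; lia. Qed.

Lemma increment1 a : increment a 1 = Num.max a 0.
Proof. by rewrite /increment; lia. Qed.

Lemma incrementN1 a : increment a (-1) = Num.min a 0.
Proof. by rewrite /increment; lia. Qed.

Lemma incrementE a g :
  increment a g = a * Num.max g 0 + Num.max (- a) 0 * g.
Proof. by rewrite /increment; nia. Qed.

Section SeedMutation.

Variables (K : fieldType) (m : nat).
Implicit Types (S : seed K m) (i j k : 'I_m).

Lemma exch_mutate S k i j :
  exch (mutate S k) i j =
  if (i == k) || (j == k) then - exch S i j
  else exch S i j + increment (exch S i k) (exch S k j).
Proof. by rewrite !mxE (inj_eq (@lshift_inj m m)). Qed.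

Lemma cmat_mutate S k i j :
  cmat (mutate S k) i j =
  if j == k then - cmat S i j
  else cmat S i j + increment (cmat S i k) (exch S k j).
Proof. by rewrite !mxE eq_rlshift. Qed.

(** Replaces the permutation matrix by an injective map of the indices, whose
    values are easier to compute with; [f i] is the index whose c-vector is the
    opposite of the basis vector of index [i]. *)
Lemma DT_is_cluster_of_C_matrix (B : 'M[int]_m) ks (f : 'I_m -> 'I_m) :
    let S := mutate_seq (init_seed K B) ks in
    injective f ->
    (forall i j, cmat S i j = - (j == f i)%:R) ->
    (forall i j, exch S (f i) (f j) = B i j) ->
  DT_is_cluster K B.
Proof.
move=> S f_inj SC SB; exists [ffun i => Defs.coord S (perm f_inj i)]; split.
  exists ks, (perm f_inj); split=> // [|i j]; last by rewrite !permE SB.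
  by apply/matrixP=> i j; rewrite SC !mxE permE eq_sym.
have reachable us S0 : cluster_reachable (init_seed K B) S0 ->
    cluster_reachable (init_seed K B) (mutate_seq S0 us).
  by elim: us S0 => //= u us IHus S0 S0P; apply/IHus/cluster_mut.
exists (relabel (perm f_inj) S); split=> //.
  exact/cluster_iso/reachable/cluster_refl.
apply/matrixP=> i j.
by rewrite /exch /relabel /= col_mxKu mxE !permE -/(exch S) SB.
Qed.

End SeedMutation.

(** * Seeds of rank 2 and pencils *)

Definition det2 (a b : int * int) : int := a.1 * b.2 - a.2 * b.1.

(** The rays of the fan of P(1,1,2): the vectors of [p] and [q] and twice the
    common vector of all the other indices add up to 0.  In the quiver, [p] and
    [q] are joined by a double arrow, and every other index forms an oriented
    triangle with them. *)
Definition pencil_frame (I : eqType) (p q j : I) : int * int :=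
  if j == p then (-1, -1) else if j == q then (-1, 1) else (1, 0).

(** The effect of the mutations at [x], [q], [p] of a pencil on a row of the
    C-matrix: [u] is the entry in column [q] when [q] is mutated, and [v] the
    entry in column [p] when [p] is mutated. *)
Definition rotate_row (I : eqType) (p q x : I) (c : I -> int) (j : I) : int :=
  let u := c q + Num.max (c x) 0 in
  let v := c p + Num.min (c x) 0 + Num.max u 0 in
  if j == x then - c x + Num.max u 0 + Num.min v 0
  else if j == q then - u + Num.max v 0
  else if j == p then - v
  else c j + Num.min u 0.

(** The rays of the fan of P^2, with two indices on each of the first two. *)
Definition triangle_frame (I : eqType) (p q y z j : I) : int * int :=
  if (j == p) || (j == q) then (-1, -1)
  else if (j == y) || (j == z) then (0, 1) else (1, 0).

(** The effect of the mutations at [y], [z], [q] of a pencil on a row of the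
    C-matrix: [u] is the entry in column [q] when [q] is mutated. *)
Definition collapse_row (I : eqType) (p q y z : I) (c : I -> int) (j : I)
    : int :=
  let u := c q + Num.max (c y) 0 + Num.max (c z) 0 in
  if j == q then - u
  else if j == p then c p + Num.min (c y) 0 + Num.min (c z) 0
  else if (j == y) || (j == z) then - c j + Num.max u 0
  else c j + Num.min u 0.

Section RankTwo.

Variables (K : fieldType) (m : nat).
Implicit Types (S : seed K m) (v : 'I_m -> int * int) (i j k p q x y z : 'I_m).

Definition framed v S := forall i j, exch S i j = det2 (v i) (v j).

(** Of the two usual mutations of the vectors, which differ by a linear map of
    determinant 1 and hence give the same exchange matrix, the one that adds
    multiples of the mutated vector to the targets of its arrows (the [j] with
    [b_kj] positive). *)
Definition mutate_frame k v j : int * int :=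
  if j == k then (- (v k).1, - (v k).2)
  else let t := Num.max (det2 (v k) (v j)) 0 in
       ((v j).1 + t * (v k).1, (v j).2 + t * (v k).2).

(** Both sides are bilinear in the vectors, and the increment of the exchange
    matrix is [b_ik max(b_kj, 0) + max(- b_ik, 0) b_kj], which is what the two
    shifted vectors contribute to the determinant. *)
Lemma framed_mutate v v' S k :
  framed v S -> mutate_frame k v =1 v' -> framed v' (mutate S k).
Proof.
move=> Sv v'E i j; rewrite exch_mutate -!v'E /mutate_frame !Sv incrementE.
rewrite /det2; case: eqP => [->|_]; case: eqP => [->|_] /=; [lia|nia|nia|].
case: (v i) (v j) (v k) => [a b] [c d] [e f] /=; nia.
Qed.

(** Given the exchange matrices, the rows of the C-matrix evolve independently
    of each other; this is the step for one row. *)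
Definition mutate_row v k (c : 'I_m -> int) j : int :=
  if j == k then - c k else c j + increment (c k) (det2 (v k) (v j)).

Lemma eq_mutate_row v k c c' : c =1 c' -> mutate_row v k c =1 mutate_row v k c'.
Proof. by move=> cE j; rewrite /mutate_row !cE. Qed.

Lemma framed_cmat v S k i :
  framed v S -> cmat (mutate S k) i =1 mutate_row v k (cmat S i).
Proof.
by move=> Sv j; rewrite cmat_mutate Sv /mutate_row; case: eqP => [->|].
Qed.

Lemma framed_cmat3 v1 v2 v3 S k1 k2 k3 i :
    framed v1 S -> framed v2 (mutate S k1) ->
    framed v3 (mutate (mutate S k1) k2) ->
  cmat (mutate (mutate (mutate S k1) k2) k3) i =1
  mutate_row v3 k3 (mutate_row v2 k2 (mutate_row v1 k1 (cmat S i))).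
Proof.
move=> S1 S2 S3 j; rewrite (framed_cmat k3 i S3); apply: eq_mutate_row => {}j.
rewrite (framed_cmat k2 i S2); apply: eq_mutate_row => {}j.
exact: framed_cmat.
Qed.

(** At each of the three steps, the mutated index has no arrow towards the
    indices other than [x], [q] and [p], so their vectors never move, and the
    vectors of [q] and [x] end where those of [p] and [q] started. *)
Lemma pencil_rotate S p q x :
    p != q -> x != p -> x != q -> framed (pencil_frame p q) S ->
  let S' := mutate_seq S [:: x; q; p] in
  framed (pencil_frame q x) S' /\
  forall i, cmat S' i =1 rotate_row p q x (cmat S i).
Proof.
move=> /negPf pq /negPf xp /negPf xq S0.
have [px qx qp] : [/\ p == x = false, q == x = false & q == p = false].
  by rewrite ![_ == x]eq_sym [q == p]eq_sym.
have case_j j : [\/ j = x, j = q, j = p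
    | [/\ j == x = false, j == q = false & j == p = false]].
  have [->|_] := eqVneq j x; first by constructor 1.
  have [->|_] := eqVneq j q; first by constructor 2.
  by have [->|_] := eqVneq j p; [constructor 3 | constructor 4].
pose v1 j : int * int := if j == x then (-1, 0) else if j == q then (0, 1)
  else pencil_frame p q j.
pose v2 j : int * int := if j == x then (-1, 1) else if j == q then (0, -1)
  else if j == p then (-1, 0) else (1, 0).
pose neqs := (eqxx, pq, xp, xq, px, qx, qp).
have S1 : framed v1 (mutate S x).
  apply: framed_mutate S0 _ => j; rewrite /mutate_frame /v1 /pencil_frame.
  by case: (case_j j) => [->|->|->|[jx jq jp]]; rewrite !neqs ?(jx, jq, jp).
have S2 : framed v2 (mutate (mutate S x) q).
  apply: framed_mutate S1 _ => j; rewrite /mutate_frame /v2 /v1 /pencil_frame.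
  by case: (case_j j) => [->|->|->|[jx jq jp]]; rewrite !neqs ?(jx, jq, jp).
have S3 : framed (pencil_frame q x) (mutate (mutate (mutate S x) q) p).
  apply: framed_mutate S2 _ => j; rewrite /mutate_frame /v2 /pencil_frame.
  by case: (case_j j) => [->|->|->|[jx jq jp]]; rewrite !neqs ?(jx, jq, jp).
split=> //= i j; rewrite (framed_cmat3 p i S0 S1 S2).
move: (cmat S i) => c; rewrite /rotate_row /mutate_row /v1 /v2 /pencil_frame.
by case: (case_j j) => [->|->|->|[jx jq jp]]; rewrite !neqs ?(jx, jq, jp)
  ?(increment0, increment1, incrementN1) ?addr0.
Qed.

(** Mutating two fibres [y] and [z] removes the double arrow between [p] and [q]
    and makes their vectors opposite; the mutation at [q] then turns the vector
    of [q] into that of [p], and moves [y] and [z] to the ray of (0, 1). *)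
Lemma pencil_collapse S p q y z :
    p != q -> y != p -> y != q -> z != p -> z != q -> y != z ->
    framed (pencil_frame p q) S ->
  let S' := mutate_seq S [:: y; z; q] in
  framed (triangle_frame p q y z) S' /\
  forall i, cmat S' i =1 collapse_row p q y z (cmat S i).
Proof.
move=> /negPf pq /negPf yp /negPf yq /negPf zp /negPf zq /negPf yz S0.
have [py qy pz qz] : [/\ p == y = false, q == y = false,
    p == z = false & q == z = false].
  by rewrite ![_ == y]eq_sym ![_ == z]eq_sym.
have [qp zy] : q == p = false /\ z == y = false.
  by rewrite ![_ == y]eq_sym [q == p]eq_sym.
have case_j j : [\/ j = y, j = z, j = q | j = p \/
    [/\ j == y = false, j == z = false, j == q = false & j == p = false]].
  have [->|_] := eqVneq j y; first by constructor 1.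
  have [->|_] := eqVneq j z; first by constructor 2.
  have [->|_] := eqVneq j q; first by constructor 3.
  by constructor 4; have [->|_] := eqVneq j p; [left | right].
pose v1 j : int * int := if j == y then (-1, 0) else if j == q then (0, 1)
  else pencil_frame p q j.
pose v2 j : int * int := if (j == y) || (j == z) then (-1, 0)
  else if j == q then (1, 1) else pencil_frame p q j.
pose neqs := (eqxx, pq, yp, yq, zp, zq, yz, py, qy, pz, qz, qp, zy).
have S1 : framed v1 (mutate S y).
  apply: framed_mutate S0 _ => j; rewrite /mutate_frame /v1 /pencil_frame.
  by case: (case_j j) => [->|->|->|[->|[jy jz jq jp]]];
    rewrite !neqs ?(jy, jz, jq, jp).
have S2 : framed v2 (mutate (mutate S y) z).
  apply: framed_mutate S1 _ => j; rewrite /mutate_frame /v2 /v1 /pencil_frame.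
  by case: (case_j j) => [->|->|->|[->|[jy jz jq jp]]];
    rewrite !neqs ?(jy, jz, jq, jp).
split=> /=.
  apply: framed_mutate S2 _ => j; rewrite /mutate_frame /v2 /pencil_frame.
  rewrite /triangle_frame.
  by case: (case_j j) => [->|->|->|[->|[jy jz jq jp]]];
    rewrite !neqs ?(jy, jz, jq, jp).
move=> i j; rewrite (framed_cmat3 q i S0 S1 S2).
move: (cmat S i) => c; rewrite /collapse_row /mutate_row /v1 /v2 /pencil_frame.
by case: (case_j j) => [->|->|->|[->|[jy jz jq jp]]];
  rewrite !neqs ?(jy, jz, jq, jp) ?(increment0, increment1, incrementN1) ?addr0
    ?orbT ?orbF //=.
Qed.

End RankTwo.

Definition ray (T : dynkin) (i : nat) : int * int :=
  if (i < 2)%N then (-1, -1)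
  else if (i < 2 + card_I2 T)%N then (0, 1) else (1, 0).

Lemma exchange_matrixE T n (i j : 'I_(n + 2)) :
  exchange_matrix T n i j = det2 (ray T i) (ray T j).
Proof.
have block_val (k : 'I_(n + 2)) : val (block T k) =
    if (k < 2)%N then 0%N else if (k < 2 + card_I2 T)%N then 1%N else 2%N.
  by rewrite /block; case: ifP => _; [|case: ifP => _]; rewrite /= inordK.
rewrite !mxE /ray /cyc -!(inj_eq val_inj) /= !block_val.
by case: (i < 2)%N (i < 2 + _)%N (j < 2)%N (j < 2 + _)%N => [] [] [] [].
Qed.

(** * Mutation by computation *)

Definition entry (M : seq (seq int)) i j : int := nth 0 (nth [::] M i) j.

Definition table r c (f : nat -> nat -> int) : seq (seq int) :=
  mkseq (fun i => mkseq (f i) c) r.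

Lemma entry_table r c f i j :
  (i < r)%N -> (j < c)%N -> entry (table r c f) i j = f i j.
Proof. by move=> ri cj; rewrite /entry !nth_mkseq. Qed.

(** Tables have [s + s] rows, the exchange matrix above the C-matrix.  Storing
    every intermediate matrix as a list keeps the cost of a word linear in its
    length; nested functions would recompute earlier entries. *)
Definition mutate_table s k M := table (s + s) s (fun i j =>
  if (i == k) || (j == k) then - entry M i j
  else entry M i j + increment (entry M i k) (entry M k j)).

Definition init_table T s := table (s + s) s (fun i j =>
  if (i < s)%N then det2 (ray T i) (ray T j) else (i - s == j)%N%:R).

Definition run_table T s w :=
  foldl (fun M k => mutate_table s k M) (init_table T s) w.

Definition all_pairs r s (P : nat -> nat -> bool) :=
  all (fun i => all (P i) (iota 0 s)) (iota 0 r).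

Lemma all_pairsP r s P i j :
  all_pairs r s P -> (i < r)%N -> (j < s)%N -> P i j.
Proof. by move=> /allP rP ri sj; apply: (allP (rP i _)); rewrite mem_iota. Qed.

Section Folding.

Variables (K : fieldType) (m s : nat).
Variables (fold : 'I_m -> nat) (single : pred 'I_m).
Hypothesis fold_lt : forall i, (fold i < s)%N.
Hypothesis fold_inj : forall i j, single i -> fold j = fold i -> j = i.

(** The table describes the seed when indices with the same image under [fold]
    are identified.  This persists as long as mutations take place at indices
    that are alone in their class: indices in one class then have the same
    arrows.  The only entries of the C-matrix that tell them apart are in their
    own rows, which are still rows of the identity matrix. *)
Definition folds M (S : seed K m) :=
  [/\ forall i j, exch S i j = entry M (fold i) (fold j),
      forall i j, single i -> cmat S i j = entry M (s + fold i) (fold j)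
    & forall i j, ~~ single i -> cmat S i j = (i == j)%:R].

Lemma fold_eq k i : single k -> (fold i == fold k) = (i == k).
Proof. by move=> k1; apply/eqP/eqP=> [/(fold_inj k1)|->]. Qed.

Lemma folds_mutate M S k :
  single k -> folds M S -> folds (mutate_table s (fold k) M) (mutate S k).
Proof.
move=> k1 [SB SC SI]; split=> i j => [|i1|i1].
- by rewrite exch_mutate entry_table ?ltn_addr // !fold_eq // !SB.
- rewrite cmat_mutate entry_table ?ltn_add2l // fold_eq // SB !SC //.
  by rewrite [(s + _ == _)%N]gtn_eqF ?ltn_addr.
- rewrite cmat_mutate !SI //.
  have /negPf ik : i != k by apply: contraNneq i1 => ->.
  case: eqP => [->|_]; first by rewrite ik oppr0.
  by rewrite ik /increment normr0 !mul0r !addr0.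
Qed.

Lemma folds_run M S ks : all single ks -> folds M S ->
  folds (foldl (fun M k => mutate_table s k M) M (map fold ks))
        (mutate_seq S ks).
Proof.
elim: ks M S => //= k ks IHks M S /andP[k1 ks1] MS.
exact/IHks/folds_mutate.
Qed.

Lemma folds_init T (B : 'M[int]_m) :
    (forall i j, B i j = det2 (ray T (fold i)) (ray T (fold j))) ->
  folds (init_table T s) (init_seed K B).
Proof.
move=> BE; split=> i j => [|i1|i1]; rewrite /exch /cmat.
- by rewrite /= col_mxKu entry_table ?ltn_addr // fold_lt.
- rewrite /= col_mxKd mxE entry_table ?ltn_add2l // ltnNge leq_addr /=.
  by rewrite addKn eq_sym [(_ == fold j)]eq_sym fold_eq.
- by rewrite /= col_mxKd mxE.
Qed.

End Folding.

Section Indices.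

Variables (m : nat) (i0 : 'I_m).

Definition ord_at k : 'I_m := insubd i0 k.

Lemma ord_atK k : (k < m)%N -> ord_at k = k :> nat.
Proof. by move=> km; rewrite val_insubd km. Qed.

Lemma eq_ord_at k (j : 'I_m) : (k < m)%N -> (j == ord_at k) = (j == k :> nat).
Proof. by move=> km; rewrite -val_eqE /= ord_atK. Qed.

End Indices.

(** * The cases settled by computation *)

(** [sg] lists the indices whose c-vectors, at the end of the word [w], are the
    opposites of the successive basis vectors. *)
Definition DT_certificate T s (w sg : seq nat) : bool :=
  let M := run_table T s w in
  [&& perm_eq sg (iota 0 s), all (fun k => k < s)%N w,
      all_pairs s s (fun i j =>
        entry M (s + i) j == - (j == nth 0%N sg i)%N%:R) &
      all_pairs s s (fun i j => entry M (nth 0%N sg i) (nth 0%N sg j)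
                                == det2 (ray T i) (ray T j))].

Lemma DT_certificateP (K : fieldType) T n w sg :
  DT_certificate T (n + 2) w sg -> DT_is_cluster K (exchange_matrix T n).
Proof.
set s := (n + 2)%N => /and4P[sgP ws SC SB].
have s_gt0 : (0 < s)%N by rewrite /s addn2.
have sg_size : size sg = s by rewrite (perm_size sgP) size_iota.
have sg_uniq : uniq sg by rewrite (perm_uniq sgP) iota_uniq.
have sg_lt (i : 'I_s) : (nth 0%N sg i < s)%N.
  have : nth 0%N sg i \in sg by rewrite mem_nth ?sg_size.
  by rewrite (perm_mem sgP) mem_iota.
pose a := ord_at (Ordinal s_gt0).
have aw : map (@nat_of_ord s) (map a w) = w.
  by rewrite -map_comp map_id_in // => k /(allP ws) ks; apply: ord_atK.
have fold_inj (i j : 'I_s) : predT i -> j = i :> nat -> j = i.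
  by move=> _ /val_inj.
have [exchE cmatE _] : folds s (@nat_of_ord s) predT (run_table T s w)
    (mutate_seq (init_seed K (exchange_matrix T n)) (map a w)).
  rewrite -[w in run_table _ _ w]aw.
  apply: (folds_run (@ltn_ord s) fold_inj (all_predT _)).
  exact: (folds_init K (@ltn_ord s) fold_inj (@exchange_matrixE T n)).
apply: (@DT_is_cluster_of_C_matrix K s _ (map a w)
         (fun i => a (nth 0%N sg i)))
  => [i j /(congr1 (@nat_of_ord s))|i j|i j].
- rewrite !ord_atK // => /eqP; rewrite nth_uniq ?sg_size // => /eqP.
  exact: val_inj.
- by rewrite cmatE // (eqP (all_pairsP SC _ _)) // eq_ord_at.
- by rewrite exchE /= !ord_atK // (eqP (all_pairsP SB _ _)) // exchange_matrixE.
Qed.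

(** The word of the general D_n without the rotations that mutate at [q] before
    [p]: the fibres 2, ..., 5 are already exhausted by the other ones. *)
Lemma DT_D4 (K : fieldType) : DT_is_cluster K (exchange_matrix typeD 4).
Proof.
apply: (@DT_certificateP _ _ _
  [:: 0; 3; 1; 0; 3; 1; 2; 4; 1; 3; 5; 1; 4; 2; 0; 5] [:: 5; 1; 0; 2; 3; 4])%N.
by vm_compute.
Qed.

(** The three words of type E are maximal green sequences: every mutation is at
    an index whose c-vector has nonnegative entries. *)
Lemma DT_E6 (K : fieldType) : DT_is_cluster K (exchange_matrix typeE 6).
Proof.
apply: (@DT_certificateP _ _ _
  [:: 1; 4; 5; 3; 7; 6; 2; 0; 1; 7; 2; 3; 4; 6; 5; 0; 1; 6; 2; 7; 5; 3; 4; 0]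
  (iota 0 8))%N.
by vm_compute.
Qed.

Lemma DT_E7 (K : fieldType) : DT_is_cluster K (exchange_matrix typeE 7).
Proof.
apply: (@DT_certificateP _ _ _
  [:: 3; 1; 0; 8; 4; 3; 6; 8; 4; 7; 8; 6; 7; 5; 2; 1; 7; 8; 0; 7; 1; 3; 4; 7;
      0; 6; 5; 0; 7; 2; 4; 3; 7; 0; 1; 8; 7]
  [:: 1; 8; 7; 6; 2; 0; 4; 5; 3])%N.
by vm_compute.
Qed.

Lemma DT_E8 (K : fieldType) : DT_is_cluster K (exchange_matrix typeE 8).
Proof.
apply: (@DT_certificateP _ _ _
  [:: 7; 4; 7; 1; 0; 3; 7; 8; 9; 4; 8; 3; 8; 9; 4; 1; 2; 6; 4; 8; 5; 1; 4; 1;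
      0; 3; 6; 1; 5; 9; 3; 1; 7; 9; 3; 9; 2; 7; 0; 8; 7; 2; 6; 9; 7; 9; 4; 5;
      8; 9; 6; 1; 9; 3; 5; 2; 1; 9; 8; 4; 2; 1; 7; 0; 9; 1]
  [:: 7; 0; 1; 8; 3; 9; 4; 2; 5; 6])%N.
by vm_compute.
Qed.

(** * Type D *)

(** The C-matrix when the pencil has the pair [(k - 2, k - 1)] and the fibres
    from [k] on have not been mutated yet.  In every row the entries in columns
    [k - 1] and [k] satisfy [c (k - 1) + max (c k) 0 >= 0], and therefore
    rotating changes the row in the columns of [k - 2], [k - 1] and [k] only. *)
Definition D_cmat (k i j : nat) : int :=
  match i with
  | 0 => if [|| j == 0, j == 2 | k <= j]%N then 1 else - (j == k.-1)%:R
  | 1 => if (k <= j)%N then 1 else - (j == k.-2)%:R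
  | 2 => if [|| j == 0 | k <= j]%N then 1 else - (j == k.-1)%:R
  | 3 => if [|| j == 2 | k <= j]%N then 1 else - (j == k.-1)%:R
  | 4 => - (j == 3)%:R
  | 5 => - (j == 4)%:R
  | 6 => - (j == 1)%:R
  | _ => if (k <= i)%N then (i == j)%:R else - (j == i.-2)%:R
  end.

Lemma D_cmat_rotate k i j : (7 <= k)%N ->
  rotate_row k.-2 k.-1 k (D_cmat k i) j = D_cmat k.+1 i j.
Proof.
(* In this form, comparisons of k with the literals of D_cmat compute. *)
move=> k7; have [l ->] : exists l, k = l.+4.+3 by exists (k - 7)%N; lia.
have [lt1 lt2] :
  (l.+4.+3 <= l.+4.+2 = false /\ l.+4.+3 <= l.+4.+1 = false)%N by lia.
have [ne1 ne2] :
  (l.+4.+2 == l.+4.+1 = false /\ l.+4.+1 == l.+4.+2 = false)%N by lia.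
rewrite /rotate_row /=; do 7! [case: i => [|i]; first by
  rewrite /= ?(leqnn, eqxx, lt1, lt2, ne1, ne2); do !case: ifPn; lia].
by rewrite /D_cmat; do !case: ifPn; lia.
Qed.

Definition D_relabel (k i : nat) : nat :=
  match i with
  | 0 => k.-1 | 1 => k.-2 | 2 => 0 | 3 => 2 | 4 => 3 | 5 => 4 | 6 => 1
  | _ => i.-2
  end.

Lemma D_cmat_collapse k i j : (7 <= k)%N -> (i < k)%N -> (j < k)%N ->
  collapse_row k.-2 k.-1 2%N 0%N (D_cmat k i) j = - (j == D_relabel k i)%:R.
Proof.
(* In this form, comparisons of k with the literals of D_cmat compute. *)
move=> k7; have [l ->] : exists l, k = l.+4.+3 by exists (k - 7)%N; lia.
have [lt1 lt2] :
  (l.+4.+3 <= l.+4.+2 = false /\ l.+4.+3 <= l.+4.+1 = false)%N by lia.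
have [ne1 ne2] :
  (l.+4.+2 == l.+4.+1 = false /\ l.+4.+1 == l.+4.+2 = false)%N by lia.
rewrite /collapse_row /=; do 7! [case: i => [|i]; first by
  rewrite /= ?(leqnn, eqxx, lt1, lt2, ne1, ne2); do !case: ifPn; lia].
by rewrite /D_cmat /D_relabel; do !case: ifPn; lia.
Qed.

(** The mutations at 0, 2, 3, the inverse of a collapse, give a pencil with
    [p = 1] and [q = 0].  They are followed by a rotation for each of the fibres
    2, ..., 6; the first four mutate at [p] before [q] and keep [p], so that
    the words are 2 1 0, 3 1 2, 4 1 3, 5 1 4, and the last one is 6 5 1.  The
    mutations at 2 on both sides of the first 3 cancel, as 2 and 3 are not
    joined. *)
Definition D_prefix : seq nat :=
  [:: 0; 3; 1; 0; 3; 1; 2; 4; 1; 3; 5; 1; 4; 6; 5; 1]%N.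

Lemma D_prefix_table : let M := run_table typeD 8 D_prefix in
  all_pairs 8 8 (fun i j =>
    entry M i j == det2 (pencil_frame 5 6 i)%N (pencil_frame 5 6 j)%N) &&
  all_pairs 7 8 (fun i j => entry M (8 + i) j == D_cmat 7 i j).
Proof. by vm_compute. Qed.

Section TypeD.

Variables (K : fieldType) (n : nat).
Hypothesis n_ge5 : (5 <= n)%N.

Let m := (n + 2)%N.

Let m_gt0 : (0 < m)%N.
Proof. by rewrite /m addn2. Qed.

Let a : nat -> 'I_m := ord_at (Ordinal m_gt0).
Let start : seed K m := init_seed K (exchange_matrix typeD n).

(** All the indices from 7 on are represented by the index 7 of the table for
    n = 6; rows of the C-matrix with these indices are untouched. *)
Lemma D_after_prefix :
  let S := mutate_seq start (map a D_prefix) in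
  framed (pencil_frame (a 5) (a 6)) S /\
  forall i j : 'I_m, cmat S i j = D_cmat 7 i j.
Proof.
pose fold (i : 'I_m) := minn i 7; pose single := [pred i : 'I_m | i < 7]%N.
have m_ge7 : (7 <= m)%N by rewrite /m; lia.
have fold_lt i : (fold i < 8)%N by rewrite /fold; lia.
have fold_inj i j : single i -> fold j = fold i -> j = i.
  by rewrite /fold /= => i7 ji; apply: val_inj => /=; lia.
have small k : (k < 7)%N -> a k = k :> nat by move=> k7; apply: ord_atK; lia.
have aD : map fold (map a D_prefix) = D_prefix.
  by rewrite /= /fold !small.
have [SB SC SI] : folds 8 fold single (run_table typeD 8 D_prefix)
    (mutate_seq start (map a D_prefix)).
  rewrite -[D_prefix in run_table _ _ D_prefix]aD.
  apply: (folds_run fold_lt fold_inj); first by rewrite /= !small.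
  apply: (folds_init K fold_lt fold_inj) => i j.
  rewrite exchange_matrixE /ray /fold /=.
  have fold_ltn (k : 'I_m) c : (c <= 7)%N -> (minn k 7 < c)%N = (k < c)%N.
    by lia.
  by rewrite !fold_ltn.
move: D_prefix_table SB SC; lazy zeta; move: (run_table _ _ _) => M.
move=> /andP[tabB tabC] SB SC.
have frameE (j : 'I_m) : pencil_frame (a 5) (a 6) j = pencil_frame 5 6 (fold j).
  rewrite /pencil_frame !eq_ord_at; [|lia|lia].
  have [-> ->] :
      (fold j == 5 = (j == 5 :> nat) /\ fold j == 6 = (j == 6 :> nat))%N.
    by rewrite /fold; lia.
  by [].
split=> [i j|i j].
  by rewrite SB (eqP (all_pairsP tabB (fold_lt i) (fold_lt j))) !frameE.
case: (boolP (single i)) => [i1|i1].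
  have foldi : fold i = i by rewrite /fold; move: i1 => /=; lia.
  rewrite SC // foldi (eqP (all_pairsP tabC i1 (fold_lt j))) /fold.
  move: i1 => /=; case: (nat_of_ord i) => [|[|[|[|[|[|[|?]]]]]]] // _;
    by rewrite /D_cmat; do ?case: ifPn; lia.
rewrite SI // -val_eqE /=; move: i1 => /=.
by case: (nat_of_ord i) => [|[|[|[|[|[|[|?]]]]]]].
Qed.

Definition D_tail (t : nat) : seq nat :=
  flatten [seq [:: k; k.-1; k.-2] | k <- iota 7 t].

Lemma D_after_tail t : (7 + t <= m)%N ->
  let S := mutate_seq start (map a (D_prefix ++ D_tail t)) in
  framed (pencil_frame (a (5 + t)) (a (6 + t))) S /\
  forall i j : 'I_m, cmat S i j = D_cmat (7 + t) i j.
Proof.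
elim: t => [|t IHt] tm; first by rewrite cats0; exact: D_after_prefix.
have [|SB SC] := IHt; first by lia.
have -> : D_tail t.+1 = D_tail t ++ [:: 7 + t; (7 + t).-1; (7 + t).-2]%N.
  by rewrite /D_tail -[t.+1]addn1 iotaD map_cat flatten_cat.
rewrite catA map_cat /mutate_seq foldl_cat; rewrite /mutate_seq in SB SC.
move: (foldl _ _ _) SB SC => S SB SC.
have neq k l : (k < m)%N -> (l < m)%N -> k != l -> a k != a l.
  by move=> km lm kl; rewrite eq_ord_at // ord_atK.
have [||| SB' SC'] := pencil_rotate _ _ _ SB (x := a (7 + t));
  try by apply: neq; lia.
rewrite !addnS; split=> // i j.
rewrite [LHS]SC' -D_cmat_rotate ?leq_addr // /rotate_row.
by rewrite !SC !eq_ord_at ?ord_atK //; lia.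
Qed.

Lemma DT_D : DT_is_cluster K (exchange_matrix typeD n).
Proof.
have m_ge7 : (7 <= m)%N by rewrite /m; lia.
pose ks := D_prefix ++ D_tail (m - 7) ++ [:: 2; 0; m.-1]%N.
have relabel_lt (i : 'I_m) : (D_relabel m i < m)%N.
  have := ltn_ord i; rewrite /D_relabel.
  by case: (nat_of_ord i) => [|[|[|[|[|[|[|?]]]]]]]; lia.
have relabel_inj (i j : 'I_m) : D_relabel m i = D_relabel m j -> i = j.
  move=> ij; apply: val_inj => /=; move: (ltn_ord i) (ltn_ord j) ij.
  rewrite /D_relabel; case: (nat_of_ord i) => [|[|[|[|[|[|[|?]]]]]]];
    by case: (nat_of_ord j) => [|[|[|[|[|[|[|?]]]]]]]; lia.
have [|SB SC] := @D_after_tail (m - 7); first by lia.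
have aa k l : (k < m)%N -> (l < m)%N -> (a k == a l) = (k == l).
  by move=> km lm; rewrite eq_ord_at // ord_atK.
have [E1 E2 E3] :
    [/\ 5 + (m - 7) = m.-2, 6 + (m - 7) = m.-1 & 7 + (m - 7) = m]%N.
  by split; lia.
rewrite E1 E2 E3 in SB SC.
have [||||||SB' SC'] := pencil_collapse _ _ _ _ _ _ SB (y := a 2) (z := a 0);
  try by rewrite aa; lia.
apply: (@DT_is_cluster_of_C_matrix K m _ (map a ks)
         (fun i => a (D_relabel m i))).
- by move=> i j /eqP; rewrite aa // => /eqP /relabel_inj.
- move=> i j; rewrite /ks catA map_cat /mutate_seq foldl_cat [LHS]SC'.
  rewrite eq_ord_at // -D_cmat_collapse // /collapse_row.
  by rewrite !SC !eq_ord_at ?ord_atK //; lia.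
move=> i j; rewrite /ks catA map_cat /mutate_seq foldl_cat [LHS]SB'.
have frameE (k : 'I_m) :
      triangle_frame (a m.-2) (a m.-1) (a 2) (a 0) (a (D_relabel m k))
      = ray typeD k.
  rewrite /triangle_frame !aa //; try lia.
  have := ltn_ord k; rewrite /D_relabel /ray.
  by case: (nat_of_ord k) => [|[|[|[|[|[|[|?]]]]]]] /=;
    do ?case: ifPn => //; lia.
by rewrite exchange_matrixE !frameE.
Qed.

End TypeD.

Theorem theorem1p1 (K : fieldType) (T : dynkin) (n : nat) :
  admissible T n -> DT_is_cluster K (exchange_matrix T n).
Proof.
case: T => /= [|]; last first.
  rewrite !inE => /or3P[] /eqP ->; [exact: DT_E6|exact: DT_E7|exact: DT_E8].
by rewrite leq_eqVlt => /predU1P[<-|/DT_D//]; exact: DT_D4.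
Qed.
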